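(* Let $X$ be a Banach space, $Y=\mathbb{R}^k$ $(k\ge1)$, $Z=\mathbb{R}^p$ $(p\ge1)$, $Q=\mathbb{R}_+^m\times\{0\}^n$ with $m+n=p$, $K\subset Y$ a proper convex cone with $\operatorname{int}K\neq\emptyset$, $L\subset S_X$ a nonempty closed set, and $f:X\to Y$, $g:X\to Z$ Fréchet differentiable. Denote by $\mu_1,\dots,\mu_m$ the first $m$ coordinate functions of $g$ and by $\nu_1,\dots,\nu_n$ the next $n$ coordinate functions of $g$, and $\nu:=(\nu_1,\dots,\nu_n)$. Suppose that $\overline{x}\in g^{-1}(-Q)$ is a local weak directional Pareto minimum point for $f$ on $g^{-1}(-Q)$ with respect to $L$. Suppose that: (i) $\operatorname{cone}L$ is convex; (ii) $\psi:X\times Z\to Z$, $\psi(x,z):=g(x)-z$, is metrically subregular at $(\overline{x},g(\overline{x}),0)$ with respect to $(\overline{x}+\operatorname{cone}L)\times(-Q)$; (iii) $\nabla\nu(\overline{x})(X)=\mathbb{R}^n$; (iv) there exists $\overline{u}\in\operatorname{int}\operatorname{cone}L$ such that $\nabla\mu_i(\overline{x})(\overline{u})<0$ for every $i\in I(\overline{x}):=\{i\in\{1,\dots,m\}\mid\mu_i(\overline{x})=0\}$ and $\nabla\nu(\overline{x})(\overline{u})=0$. Then there exist $y^*\in K^+\setminus\{0\}$, $\lambda_i\ge0$ for $i\in\{1,\dots,m\}$ and $\tau_j\in\mathbb{R}$ for $j\in\{1,\dots,n\}$ such that $$0\in y^*\circ\nabla f(\overline{x})+\sum_{i=1}^m\lambda_i\nabla\mu_i(\overline{x})+\sum_{j=1}^n\tau_j\nabla\nu_j(\overline{x})+L^-$$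 and $$\lambda_i\mu_i(\overline{x})=0,\quad\forall i\in\{1,\dots,m\}.$$
   Context: $S_X$ is the unit sphere of $X$; $\operatorname{cone}C=\{tc\mid t\ge0,\ c\in C\}$. A convex cone $K$ is proper if $K\neq\{0\}$ and $K\neq Y$ (not necessarily pointed). $K^+=\{y^*\in Y^*\mid y^*(y)\ge0\ \forall y\in K\}$ and $L^-=\{x^*\in X^*\mid x^*(\ell)\le0\ \forall\ell\in L\}$. $\nabla$ denotes the Fréchet derivative. Products carry the sum norm. Local weak directional Pareto minimum: with $A=g^{-1}(-Q)$, $\overline{x}\in A$ is a local weak directional Pareto minimum point for $f$ on $A$ with respect to $L$ if there is a neighborhood $U$ of $\overline{x}$ such that $f(x)-f(\overline{x})\notin-\operatorname{int}K$ for all $x\in U\cap A\cap(\overline{x}+\operatorname{cone}L)$. Metric subregularity with respect to a set: a function $h:W\to V$ between normed spaces is metrically subregular at $(\overline{w},h(\overline{w}))\in D\times V$ with respect to a nonempty closed set $D\subset W$ if there exist $s>0$, $\mu>0$ such that for every $w\in B(\overline{w},s)\cap D$, $d(w,h^{-1}(h(\overline{w}))\cap D)\le\mu\|h(\overline{w})-h(w)\|$. Here this is applied to $h=\psi$, $\overline{w}=(\overline{x},g(\overline{x}))$, $\psi(\overline{w})=0$ and $D=(\overline{x}+\operatorname{cone}L)\times(-Q)$. *)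

(* Defs.v *)
From HB Require Import structures.
From mathcomp Require Import all_boot all_order all_algebra.
From mathcomp Require Import all_classical all_reals all_analysis.

Set Implicit Arguments.
Unset Strict Implicit.
Unset Printing Implicit Defensive.
Import Order.TTheory GRing.Theory Num.Theory.
Import numFieldNormedType.Exports.
Local Open Scope classical_set_scope.
Local Open Scope ring_scope.

Section Cones.
Context {R : realType} {V : normedModType R}.

Definition unit_sphere : set V := [set x | `|x| = 1].

Definition cone (C : set V) : set V :=
  [set v | exists t c, [/\ 0 <= t, C c & v = t *: c]].

Definition translate (x : V) (C : set V) : set V := [set x + v | v in C].

Definition setopp (C : set V) : set V := [set - v | v in C].

Definition proper_convex_cone (K : set V) : Prop :=
  [/\ K !=set0, cone K `<=` K, convex_set K, K <> [set 0] & K <> setT].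

(* The topological dual V^*, as a set of functions: the pointwise operations
   of V -> R^o are those of V^*. *)
Definition dual : set (V -> R^o) :=
  [set phi | linear phi /\ continuous phi].

Definition dual_cone (K : set V) : set (V -> R^o) :=
  [set phi | dual phi /\ forall y, K y -> 0 <= phi y].

Definition polar_cone (L : set V) : set (V -> R^o) :=
  [set phi | dual phi /\ forall l, L l -> phi l <= 0].

End Cones.

Definition local_weak_dir_pareto_min {R : realType} {X Y : normedModType R}
    (f : X -> Y) (A : set X) (K : set Y) (L : set X) (xbar : X) : Prop :=
  A xbar /\
  exists2 U : set X, nbhs xbar U &
    forall x, (U `&` A `&` translate xbar (cone L)) x ->
      ~ setopp (interior K) (f x - f xbar).

(* The canonical norm of X * Z in the library is the max norm. *)
Definition sum_norm {R : realType} {X Z : normedModType R} (w : X * Z) : R :=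
  `|w.1| + `|w.2|.

(* The infimum is taken in \bar R, so that the distance to set0 is +oo. *)
Definition dist_to {R : realType} {W : zmodType} (N : W -> R)
    (w : W) (S : set W) : \bar R :=
  ereal_inf [set (N (w - v))%:E | v in S].

(* N is the norm with which the zmodType W is considered. *)
Definition metrically_subregular {R : realType} {W : zmodType}
    {V : normedModType R} (N : W -> R) (h : W -> V) (wbar : W) (D : set W)
    : Prop :=
  exists s mu : R, [/\ 0 < s, 0 < mu &
    forall w, N (w - wbar) < s -> D w ->
      (dist_to N w (h @^-1` [set h wbar] `&` D)
         <= (mu * `|h wbar - h w|)%:E)%E].

Section Constraints.
Context {R : realType} {m n : nat}.

(* R_+^m x {0}^n *)
Definition Qcone : set 'rV[R]_(m + n) :=
  [set z | (forall i : 'I_m, 0 <= z 0 (lshift n i)) /\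
           (forall j : 'I_n, z 0 (rshift m j) = 0)].

Context {X : Type}.

Definition ineq_coord (g : X -> 'rV[R]_(m + n)) (i : 'I_m) : X -> R^o :=
  fun x => g x 0 (lshift n i).

Definition eq_coord (g : X -> 'rV[R]_(m + n)) (j : 'I_n) : X -> R^o :=
  fun x => g x 0 (rshift m j).

Definition eq_part (g : X -> 'rV[R]_(m + n)) : X -> 'rV[R]_n :=
  fun x => \row_j eq_coord g j x.

End Constraints.

(* Main.v *)
(** Let C = cone L and D = x + C. A direction u in C along which the active
    inequalities decrease to first order and the equalities are stationary is
    tangent to the feasible set: (x + t u, g x + t dg u) lies in D * (-Q) for
    small t > 0 and violates g y = z by o(t) only, so metric subregularity
    corrects it to a feasible point of D at distance o(t). Weak minimality then
    forbids df u in - int K. Hence the convex cone of the pairs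
    (df u + y, dg u + z), with u in C, y in int K, z positive on the active
    inequalities and zero on the equalities, avoids 0; it has an algebraic
    interior point because u_bar is interior to C and dnu is onto. The
    coefficients of a separating functional are the multipliers. If y* = 0,
    evaluating the functional at u_bar kills all the lambda_i, and then the
    functional vanishes at the interior point, which is absurd. *)
Require Import Defs.
From HB Require Import structures.
From mathcomp Require Import all_boot all_order all_algebra.
From mathcomp Require Import ring lra.
From mathcomp Require Import all_classical all_reals all_analysis.

Set Implicit Arguments.
Unset Strict Implicit.
Unset Printing Implicit Defensive.
Import Order.TTheory GRing.Theory Num.Theory.
Import numFieldNormedType.Exports.
Local Open Scope classical_set_scope.
Local Open Scope ring_scope.

(** * Separation of a convex cone from 0 in finite dimension *)

Section Separation.
Context {R : realType}.

(** Homogeneity is an inequality for t > 0, which is quick to check for infima; applying it to 1/t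
    as well turns it into an equality. *)
Definition sublinear (V : lmodType R) (p : V -> R) : Prop :=
  (forall x y, p (x + y) <= p x + p y) /\
  (forall t x, 0 < t -> p (t *: x) <= t * p x).

Lemma sublinear0 (V : lmodType R) (p : V -> R) : sublinear p -> p 0 = 0.
Proof.
move=> [pD pZ]; apply: le_anti; apply/andP; split.
  by have := pZ 2^-1 0; rewrite scaler0 => /(_ ltac:(lra)); lra.
by have := pD 0 0; rewrite addr0; lra.
Qed.

Lemma sublinearZ (V : lmodType R) (p : V -> R) t x :
  sublinear p -> 0 <= t -> p (t *: x) = t * p x.
Proof.
move=> sp; rewrite le_eqVlt => /predU1P[<-|t0].
  by rewrite scale0r mul0r sublinear0.
apply: le_anti; rewrite sp.2//= -ler_pdivlMl//.
by rewrite (le_trans _ (sp.2 _ _ _)) ?invr_gt0// scalerA mulVf ?gt_eqF ?scale1r.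
Qed.

Lemma sublinearN (V : lmodType R) (p : V -> R) x :
  sublinear p -> 0 <= p x + p (- x).
Proof. by move=> sp; rewrite -(sublinear0 sp) -{1}(subrr x) sp.1. Qed.

Section InfSublinear.
Context (V : lmodType R) (G : V -> set R).
Hypothesis G_neq0 : forall x, G x !=set0.
Hypothesis G0_ge0 : forall r, G 0 r -> 0 <= r.
Hypothesis GD : forall x y r s, G x r -> G y s -> G (x + y) (r + s).
Hypothesis GZ : forall t x r, 0 < t -> G x r -> G (t *: x) (t * r).

(** The graph of [G] is a convex cone in V x R whose fibre over 0 is nonnegative. For s in
    [G (- x)], r + s lies in that fibre, so - s bounds [G x] from below and the infimum is a genuine
    one. *)
Lemma inf_sublinear_le x r : G x r -> inf (G x) <= r.
Proof.
apply: ge_inf; have [s Gs] := G_neq0 (- x).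
by exists (- s) => u Gu; rewrite lerNl -subr_ge0 opprK; apply: G0_ge0;
  rewrite -(addNr x); apply: GD.
Qed.

Lemma inf_sublinear : sublinear (fun x => inf (G x)).
Proof.
split=> [x y|t x t0].
  rewrite -lerBlDr; apply: lb_le_inf => // r Gr; rewrite lerBlDr -lerBlDl.
  by apply: lb_le_inf => // s Gs; rewrite lerBlDl; apply/inf_sublinear_le/GD.
rewrite -ler_pdivrMl//; apply: lb_le_inf => // r Gr; rewrite ler_pdivrMl//.
exact/inf_sublinear_le/GZ.
Qed.

End InfSublinear.

(* The minorant [q x = inf_(t >= 0) (p (x + t e) - t p e)] is linear on the
   line spanned by [e]; since [q <= p], it stays linear wherever [p] was, so
   the vectors of a basis can be treated one after the other. *)
Lemma sublinear_linearize (V : lmodType R) (p : V -> R) (e : V) :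
  sublinear p ->
  exists q, [/\ sublinear q, forall x, q x <= p x & q e + q (- e) <= 0].
Proof.
move=> sp.
pose G x := [set p (x + t *: e) - t * p e | t in [set t : R | 0 <= t]].
have G0_ge0 r : G 0 r -> 0 <= r.
  by move=> [t /= t0 <-]; rewrite add0r sublinearZ// subrr.
(* Subadditivity of [p] only bounds a value of [G (x + y)] above by a sum of values, so the fibres
   are closed upwards to become additive. *)
pose H x := [set r : R | exists2 s, G x s & s <= r].
have Hp x : H x (p x).
  exists (p x) => //; exists 0 => //=.
  by rewrite scale0r addr0 mul0r subr0.
have H_neq0 x : H x !=set0 by exists (p x).
have H0_ge0 r : H 0 r -> 0 <= r by move=> [s /G0_ge0]; apply: le_trans.
have HD x y r s : H x r -> H y s -> H (x + y) (r + s).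
  move=> [_ [t /= t0 <-] tr] [_ [u /= u0 <-] us].
  exists (p (x + y + (t + u) *: e) - (t + u) * p e).
    by exists (t + u) => //=; apply: addr_ge0.
  have := sp.1 (x + t *: e) (y + u *: e).
  by rewrite scalerDl addrACA mulrDl; lra.
have HZ t x r : 0 < t -> H x r -> H (t *: x) (t * r).
  move=> t0 [_ [u /= u0 <-] ur].
  exists (p (t *: x + (t * u) *: e) - (t * u) * p e).
    by exists (t * u) => //=; rewrite mulr_ge0// ltW.
  rewrite -scalerA -scalerDr sublinearZ ?(ltW t0)// -mulrA -mulrBr.
  by rewrite ler_pM2l.
exists (fun x => inf (H x)); split.
- exact: inf_sublinear.
- by move=> x; apply: inf_sublinear_le.
have := inf_sublinear_le H_neq0 H0_ge0 HD (Hp e).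
(* Taking t = 1 at [- e] gives the value p 0 - p e = - p e, which offsets the bound q e <= p e. *)
suff /(inf_sublinear_le H_neq0 H0_ge0 HD) : H (- e) (- p e) by lra.
exists (- p e) => //; exists 1 => //=.
by rewrite scale1r addNr mul1r sublinear0// add0r.
Qed.

Lemma sublinear_linearize_seq (V : lmodType R) (p : V -> R) (s : seq V) :
  sublinear p ->
  exists q, [/\ sublinear q, forall x, q x <= p x &
             forall e, e \in s -> q e + q (- e) <= 0].
Proof.
move=> sp; elim: s => [|e s [q [sq qp qs]]]; first by exists p.
have [q' [sq' q'q q'e]] := sublinear_linearize e sq.
exists q'; split=> // [x|x]; first exact: le_trans (qp _).
rewrite inE => /predU1P[->//|/qs]; apply: le_trans.
exact: lerD.
Qed.

(** A finite basis takes the place of Zorn's lemma: the x with q x + q (- x) <= 0 form a subspace,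
    and [q] has been linearized along a basis, so this subspace is everything and [q] itself is
    linear. *)
Lemma hahn_banach_vect (V : vectType R) (p : V -> R) :
  sublinear p -> exists phi : {linear V -> R^o}, forall x, phi x <= p x.
Proof.
move=> /(sublinear_linearize_seq (vbasis fullv))[q [sq qp qb]].
have qD0 x y : q x + q (- x) <= 0 -> q y + q (- y) <= 0 ->
    q (x + y) + q (- (x + y)) <= 0.
  by move=> hx hy; rewrite opprD; have := sq.1 x y; have := sq.1 (- x) (- y); lra.
have qZ0 t x : q x + q (- x) <= 0 -> q (t *: x) + q (- (t *: x)) <= 0.
  move=> hx; have [t0|t0] := leP 0 t.
    rewrite -scalerN !(sublinearZ _ sq)// -mulrDr.
    by rewrite -oppr_ge0 -mulrN mulr_ge0// oppr_ge0.
  have -> : t *: x = (- t) *: (- x) by rewrite scalerN scaleNr opprK.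
  rewrite -scalerN opprK !(sublinearZ _ sq) ?oppr_ge0 ?(ltW t0)//.
  rewrite -mulrDr [q (- x) + _]addrC.
  by rewrite -oppr_ge0 -mulrN mulr_ge0 ?oppr_ge0 // ltW.
have q0 x : q (- x) = - q x.
  suff: q x + q (- x) <= 0 by have := sublinearN x sq; lra.
  rewrite (coord_vbasis (memvf x)).
  apply: (big_ind (fun y => q y + q (- y) <= 0)) => //.
    by rewrite oppr0 (sublinear0 sq) addr0.
  by move=> i _; apply/qZ0/qb; rewrite mem_nth ?size_tuple.
have qD x y : q (x + y) = q x + q y.
  apply: le_anti; rewrite sq.1/= -lerBrDr -q0.
  by have := sq.1 (x + y) (- y); rewrite addrK.
have qZ t x : q (t *: x) = t * q x.
  have [t0|t0] := leP 0 t; first exact: sublinearZ.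
  have -> : t *: x = - ((- t) *: x) by rewrite scaleNr opprK.
  by rewrite q0 sublinearZ ?oppr_ge0 ?(ltW t0)// mulNr opprK.
have lq : linear (q : V -> R^o) by move=> t x y; rewrite qD qZ.
pose qM := GRing.isLinear.Build _ _ _ _ _ lq.
pose phi : {linear V -> R^o} := HB.pack (q : V -> R^o) qM.
by exists phi.
Qed.

(* Up to sign, the functional is a linear minorant of the gauge
   [v |-> inf {t | v + t s0 in S}]. *)
Lemma cone_separation (V : vectType R) (S : set V) (s0 : V) :
  (forall x y, S x -> S y -> S (x + y)) ->
  (forall t x, 0 < t -> S x -> S (t *: x)) ->
  (forall v, exists2 t, 0 < t & S (s0 + t *: v)) ->
  ~ S 0 ->
  exists phi : {linear V -> R^o}, (forall x, S x -> 0 <= phi x) /\ 0 < phi s0.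
Proof.
move=> SD SZ S_int S0.
have Ss0 : S s0 by have [t _] := S_int 0; rewrite scaler0 addr0.
pose G v := [set t | S (v + t *: s0)].
have G_neq0 v : G v !=set0.
  have [t t0 St] := S_int v; exists t^-1.
  have := SZ t^-1 _ _ St; rewrite invr_gt0 => /(_ t0).
  by rewrite scalerDr scalerA mulVf ?gt_eqF// scale1r addrC.
have G0_ge0 r : G 0 r -> 0 <= r.
  rewrite /G/= add0r => Sr; rewrite leNgt; apply/negP => r0; apply: S0.
  rewrite -(addrN (r *: s0)); apply: SD => //.
  by rewrite -scaleNr; apply: SZ; rewrite ?oppr_gt0.
have GD x y r s : G x r -> G y s -> G (x + y) (r + s).
  by rewrite /G/= => Gx Gy; rewrite scalerDl addrACA; apply: SD.
have GZ t x r : 0 < t -> G x r -> G (t *: x) (t * r).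
  by rewrite /G/= => t0 Gx; rewrite -scalerA -scalerDr; apply: SZ.
have [phi phi_le] := hahn_banach_vect (inf_sublinear G_neq0 G0_ge0 GD GZ).
have phiG x r : G x r -> phi x <= r.
  by move=> /(inf_sublinear_le G_neq0 G0_ge0 GD); apply: le_trans.
exists (phi \o -%R) => /=; split=> [x Sx|].
  by rewrite linearN oppr_ge0; apply: phiG; rewrite /G/= scale0r addr0.
rewrite linearN oppr_gt0.
(* The point s0 - s0 / 2 is a positive multiple of [s0], hence in [S], so the gauge of [s0] is at
   most - 1/2. *)
apply: (@le_lt_trans _ _ (- 2^-1)); last by rewrite oppr_lt0 invr_gt0.
apply: phiG; rewrite /G/= -{1}(scale1r s0) -scalerDl.
by apply: SZ => //; lra.
Qed.

End Separation.

(** * First-order expansions along a ray *)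

Section FirstOrder.
Context {R : realType} {V W : normedModType R}.

Lemma differentiable_expansion (f : V -> W) (x : V) (e : R) :
  differentiable f x -> 0 < e ->
  exists2 d, 0 < d & forall h, `|h| < d ->
    `|f (x + h) - f x - 'd f x h| <= e * `|h|.
Proof.
move=> df e0; have [_ fo] := (diff_locallyP x f).1 df.
have /nbhs_ballP[d /= d0 Hd] := (eqaddoP _ _ _ _).1 fo e e0.
exists d => // h hd; have := Hd h.
rewrite -ball_normE /= sub0r normrN => /(_ hd).
by rewrite /= opprD addrA [x + h]addrC.
Qed.

(** The endpoint may miss the ray by [d * t], so that the estimate also covers points obtained by
    correcting x + t u. With h = y - x, the error is the remainder at h plus the differential at h -
    t u; each gets half of [e * t]. *)
Lemma diff_expansion_along (f : V -> W) (x u : V) (e : R) :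
  differentiable f x -> 0 < e ->
  exists2 d, 0 < d & forall t y, 0 < t < d -> `|x + t *: u - y| <= d * t ->
    `|f y - f x - t *: 'd f x u| <= e * t.
Proof.
move=> df e0.
have [M M0 HM] := linear_lipschitz (diff_continuous df).
have u1 : 0 < `|u| + 1 by rewrite ltr_wpDl.
pose e1 := e / (2 * (`|u| + 1)).
have e10 : 0 < e1 by rewrite divr_gt0// mulr_gt0.
have [r r0 Hr] := differentiable_expansion df e10.
(* The bound 1 yields |h| <= t (|u| + 1), the second bound controls the differential of h - t u, and
   the third keeps h where the expansion holds. *)
pose d := Num.min 1 (Num.min (e / (2 * M)) (r / (`|u| + 1))).
have d0 : 0 < d by rewrite !lt_min ltr01 !divr_gt0// ?mulr_gt0.
have d1 : d <= 1 by rewrite ge_min lexx.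
have dM : M * d <= e / 2.
  rewrite mulrC -ler_pdivlMr// -mulrA -invfM.
  by rewrite !ge_min lexx orbT.
have du : d * (`|u| + 1) <= r.
  by rewrite -ler_pdivlMr // !ge_min lexx !orbT.
exists d => // t y /andP[t0 td] hy; pose h := y - x.
have huy : `|h - t *: u| <= d * t.
  by rewrite -normrN opprB /h opprB addrA [_ *: _ + _]addrC.
have yE : y = x + h by rewrite /h subrKC.
clearbody h.
have hh : `|h| <= t * (`|u| + 1).
  rewrite -(subrK (t *: u) h) (le_trans (ler_normD _ _))// normrZ gtr0_norm//.
  by rewrite addrC mulrDr mulr1 lerD2l (le_trans huy)// ler_piMl// ltW.
have hr : `|h| < r.
  by rewrite (le_lt_trans hh)// (lt_le_trans _ du)// ltr_pM2r.
have -> : f y - f x - t *: 'd f x u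
    = (f (x + h) - f x - 'd f x h) + 'd f x (h - t *: u).
  have -> : 'd f x (h - t *: u) = 'd f x h - t *: 'd f x u.
    by rewrite linearB linearZ.
  by rewrite addrA subrK yE.
rewrite (le_trans (ler_normD _ _))//.
have -> : e * t = e1 * (t * (`|u| + 1)) + e / 2 * t.
  by rewrite /e1; field; rewrite gt_eqF.
apply: lerD.
  by rewrite (le_trans (Hr _ hr))// ler_pM2l.
rewrite (le_trans (HM _))// (le_trans (ler_wpM2l (ltW M0) huy))//.
by rewrite mulrA ler_pM2r.
Qed.

Lemma nbhs_segment (A : set V) (v w : V) :
  nbhs v A -> exists2 d : R, 0 < d & forall t, `|t| < d -> A (v + t *: w).
Proof.
move=> Av; have : nbhs (0 : R^o) [set t | A (v + t *: w)].
  have : {for (0 : R^o), continuous (fun t : R^o => v + t *: w)}.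
    by apply: cvgD; [exact: cvg_cst | exact: scalel_continuous].
  by apply; rewrite scale0r addr0.
move=> /nbhs_ballP[d /= d0 Hd]; exists d => // t td.
by apply: Hd; rewrite -ball_normE /= sub0r normrN.
Qed.

End FirstOrder.

(** * Algebra of cones and of their interiors *)

Section Cones.
Context {R : realType} {V : normedModType R}.

Lemma coneZ (C : set V) (t : R) (v : V) : 0 <= t -> cone C v -> cone C (t *: v).
Proof.
move=> t0 [s [c [s0 Cc ->]]]; exists (t * s), c.
by rewrite scalerA mulr_ge0.
Qed.

Lemma subset_cone (C : set V) : C `<=` cone C.
Proof. by move=> c Cc; exists 1, c; rewrite scale1r. Qed.

Lemma cone0 (C : set V) : C !=set0 -> cone C 0.
Proof. by move=> [c Cc]; exists 0, c; rewrite scale0r. Qed.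

Lemma convex_coneD (C : set V) (x y : V) :
  (forall t x, 0 < t -> C x -> C (t *: x)) ->
  convex_set C -> C x -> C y -> C (x + y).
Proof.
move=> CZ Cc Cx Cy.
(* The sum is twice the midpoint. *)
have h0 : 0 <= 2^-1 :> R by [].
have h1 : 2^-1 <= 1 :> R by lra.
have := Cc x y (Itv01 h0 h1); rewrite !inE => /(_ Cx Cy).
rewrite -[conv _ _ _]/(2^-1 *: x + (1 - 2^-1) *: y).
have -> : 1 - 2^-1 = 2^-1 :> R by lra.
move=> /(CZ 2 _ ltac:(lra)).
by rewrite scalerDr !scalerA mulfV ?scale1r.
Qed.

Lemma interior_coneD (C : set V) (x y : V) :
  (forall x y, C x -> C y -> C (x + y)) -> interior C x -> C y ->
  interior C (x + y).
Proof.
move=> CD Cx Cy.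
have /(_ C) : (z - y) @[z --> x + y] --> x.
  rewrite -{2}(addrK y x).
  exact: (cvgB cvg_id (cvg_cst y)).
move=> /(_ Cx) CB; rewrite /interior /=; near=> z.
rewrite -(subrK y z); apply: CD => //.
by near: z; exact: CB.
Unshelve. all: by end_near.
Qed.

Lemma interior_coneZ (C : set V) (t : R) (x : V) :
  (forall t x, 0 < t -> C x -> C (t *: x)) -> 0 < t -> interior C x ->
  interior C (t *: x).
Proof.
move=> CZ t0 Cx.
have /(_ C) : (t^-1 *: z) @[z --> t *: x] --> x.
  rewrite -{2}(scale1r x) -(mulVf (lt0r_neq0 t0)) -scalerA.
  exact: scaler_continuous.
move=> /(_ Cx) CV; rewrite /interior /=; near=> z.
rewrite -(scale1r z) -(mulfV (lt0r_neq0 t0)) -scalerA; apply: CZ => //.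
by near: z; exact: CV.
Unshelve. all: by end_near.
Qed.

Lemma setoppE (C : set V) (x : V) : setopp C x = C (- x).
Proof.
by apply/propext; split=> [[y Cy <-]|Cx]; rewrite ?opprK//; exists (- x) => //;
  rewrite opprK.
Qed.

End Cones.

(** * Tangent directions and weak minimality *)

Section FeasibleDirections.
Context {R : realType} {X Y Z : normedModType R}.

Lemma subregular_tangent (g : X -> Z) (D : set X) (M : set Z) (x u : X) :
  differentiable g x ->
  metrically_subregular sum_norm (fun w : X * Z => g w.1 - w.2) (x, g x)
    (D `*` M) ->
  (exists2 d : R, 0 < d &
    forall t, 0 < t < d -> D (x + t *: u) /\ M (g x + t *: 'd g x u)) ->
  forall e : R, 0 < e -> exists2 d : R, 0 < d & forall t, 0 < t < d ->
    exists y, [/\ D y, M (g y) & `|x + t *: u - y| <= e * t].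
Proof.
move=> dg [s [mu [s0 mu0 sub]]] [d1 d10 H1] e e0.
(* After multiplication by [mu] the residual is at most e t / 2; the spare factor 2 makes the
   distance strictly less than e t, so that a point realizing this bound exists. *)
have e1 : 0 < e / (2 * mu) by rewrite divr_gt0// mulr_gt0.
have [d2 d20 H2] := diff_expansion_along u dg e1.
pose N := `|u| + `|'d g x u| + 1.
have N0 : 0 < N by rewrite ltr_wpDl// addr_ge0.
exists (Num.min (Num.min d1 d2) (s / N)).
  by rewrite !lt_min d10 d20 divr_gt0.
move=> t; rewrite !lt_min => /and3P[t0 /andP[td1 td2]].
rewrite ltr_pdivlMr// => tN.
have [Dt Mt] := H1 t ltac:(by rewrite t0).
have /(_ ltac:(by rewrite t0)) := H2 t (x + t *: u).
rewrite subrr normr0 => /(_ (mulr_ge0 (ltW d20) (ltW t0))) Ht.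
pose w := (x + t *: u, g x + t *: 'd g x u).
have w_near : sum_norm (w - (x, g x)) < s.
  rewrite /sum_norm /= [x + _]addrC [g x + _]addrC !addrK.
  rewrite !normrZ gtr0_norm// -mulrDr (lt_trans _ tN)// ltr_pM2l//.
  by rewrite ltrDl.
have dist_le := sub w w_near (conj Dt Mt).
have rhs_lt : mu * `|g x - g x - (g w.1 - w.2)| < e * t.
  rewrite subrr sub0r normrN /= opprD addrA.
  apply: (le_lt_trans (ler_wpM2l (ltW mu0) Ht)).
  have -> : mu * (e / (2 * mu) * t) = e / 2 * t by field; rewrite gt_eqF.
  by rewrite ltr_pM2r// gtr_pMr// invf_lt1// ltr1n.
rewrite -lte_fin in rhs_lt.
(* The corrected pair is a zero of g y - z, so z = g y and membership of z in [M] becomes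
   feasibility of y. *)
have /ereal_inf_lt[_ [[y z] /= [/= yz [Dy Mz]] <-]] :=
  le_lt_trans dist_le rhs_lt.
rewrite lte_fin /sum_norm /= => h.
exists y; split => //; first by move: yz; rewrite subrr => /subr0_eq ->.
by rewrite (le_trans _ (ltW h))// lerDl.
Qed.

(** Along feasible points y within o(t) of x + t u, (f x - f y) / t tends to - df u. If that limit
    were interior to [K], f x - f y would be too for small t, against minimality. *)
Lemma no_descent_direction (f : X -> Y) (A : set X) (K : set Y) (L : set X)
    (x u : X) :
  (forall t y, 0 < t -> K y -> K (t *: y)) ->
  local_weak_dir_pareto_min f A K L x -> differentiable f x ->
  (forall e : R, 0 < e -> exists2 d : R, 0 < d & forall t, 0 < t < d ->
    exists y, [/\ translate x (cone L) y, A y & `|x + t *: u - y| <= e * t]) ->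
  ~ interior K (- 'd f x u).
Proof.
move=> KZ [_ [U Ux Umin]] df feas.
move=> Ku; have := open_interior (K : set Y); rewrite openE => /(_ _ Ku).
move=> /nbhs_ballP[r /= r0 Kball].
have r20 : 0 < r / 2 by rewrite divr_gt0.
have [d1 d10 H1] := diff_expansion_along u df r20.
have [rho /= rho0 HU] := (nbhs_ballP _ _).1 Ux.
have [d2 d20 H2] := feas _ d10.
(* Since |x - y| <= t (|u| + d1), the bound t N < rho puts y in the neighbourhood [U] of
   minimality. *)
pose N := `|u| + d1 + 1.
have N0 : 0 < N by rewrite ltr_wpDl// addr_ge0// ltW.
pose d := Num.min (Num.min d1 d2) (rho / N).
have d0 : 0 < d by rewrite !lt_min d10 d20 divr_gt0.
pose t := d / 2.
have t0 : 0 < t by rewrite divr_gt0.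
have : t < d by rewrite gtr_pMr// invf_lt1// ltr1n.
rewrite /d !lt_min => /andP[/andP[td1 td2]].
rewrite ltr_pdivlMr// => tN.
have [|y [Dy Ay xy]] := H2 t; first by rewrite t0.
have Uy : U y.
  apply: HU; rewrite -ball_normE /=.
  have -> : x - y = (x + t *: u - y) - t *: u.
    by rewrite [x + _ - y]addrAC addrK.
  rewrite (le_lt_trans (ler_normB _ _))// normrZ gtr0_norm//.
  rewrite (le_lt_trans _ tN)// (le_trans (lerD xy (lexx _)))//.
  by rewrite mulrC -mulrDr ler_pM2l// addrC lerDl.
apply: (Umin y) => //; rewrite setoppE opprB.
have -> : f x - f y = t *: (t^-1 *: (f x - f y)).
  by rewrite scalerA mulfV ?gt_eqF// scale1r.
apply: interior_coneZ => //.
have /(_ ltac:(by rewrite t0) xy) Hy := H1 t y.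
apply: Kball; rewrite -ball_normE /=.
have -> : - 'd f x u - t^-1 *: (f x - f y)
    = t^-1 *: (f y - f x - t *: 'd f x u).
  rewrite [RHS]scalerBr scalerA mulVf ?gt_eqF// scale1r.
  by rewrite -scalerN opprB addrC.
rewrite normrZ gtr0_norm ?invr_gt0// ltr_pdivrMl//.
by rewrite (le_lt_trans Hy)// mulrC ltr_pM2l// gtr_pMr// invf_lt1// ltr1n.
Qed.

End FeasibleDirections.

(** * Linear maps and coordinates on row vectors *)

Section Coordinates.
Context {R : realType}.

Lemma diff_comp_linear (X V W : normedModType R) (h : V -> W) (g : X -> V)
    (x : X) :
  linear h -> continuous h -> differentiable g x ->
  'd (h \o g) x = h \o 'd g x :> (X -> W).
Proof.
move=> lh ch dg; pose hM := GRing.isLinear.Build _ _ _ _ _ lh.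
pose hL : {linear V -> W} := HB.pack h hM.
have -> : h = hL by [].
rewrite diff_comp//; last exact: linear_differentiable.
by rewrite diff_lin.
Qed.

(** A linear form on rows is a finite sum of coordinates with constant weights. *)
Lemma linear_row_continuous (p : nat) (h : 'rV[R]_p -> R^o) :
  linear h -> continuous h.
Proof.
move=> lh; pose hM := GRing.isLinear.Build _ _ _ _ _ lh.
pose hL : {linear 'rV[R]_p -> R^o} := HB.pack h hM.
have -> : h = fun z => \sum_i z 0 i * h (delta_mx 0 i).
  apply/funext => z; rewrite -[h]/(hL : _ -> _) {1}(row_sum_delta z) linear_sum.
  by apply: eq_bigr => i _; rewrite linearZ.
apply: continuous_big => [|i _ z]; first exact: add_continuous.
exact: (cvgM (coord_continuous (x := z)) (cvg_cst (h (delta_mx 0 i) : R))).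
Qed.

Lemma nbhs_coord_gt0 (p : nat) (P : 'I_p -> Prop) (z : 'rV[R]_p) :
  (forall i, P i -> 0 < z 0 i) ->
  nbhs z [set y : 'rV[R]_p | forall i, P i -> 0 < y 0 i].
Proof.
move=> zP.
have Pnear i : \forall y \near z, (P i -> 0 < (y : 'rV[R]_p) 0 i).
  have [Pi|nPi] := pselect (P i); last by near=> y => /nPi.
  have : y 0 i @[y --> z] --> z 0 i by exact: coord_continuous.
  move=> /(cvgr_gt _)/(_ _ (zP _ Pi)) yz.
  by near=> y => _; near: y; exact: yz.
exact: filter_forall Pnear.
Unshelve. all: by end_near. Qed.

(** Source of all the sign conditions on the multipliers: a fixed base point of the cone is pushed
    arbitrarily far along a direction. If b < 0, t = (|a| + 1) / (- b) gives a - |a| - 1 < 0. *)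
Lemma ge0_affine_slope (a b : R) :
  (forall t, 0 < t -> 0 <= a + t * b) -> 0 <= b.
Proof.
move=> ab; rewrite leNgt; apply/negP => b0.
have t0 : 0 < (`|a| + 1) / - b by rewrite divr_gt0 ?oppr_gt0 ?ltr_wpDl.
have := ab _ t0; rewrite leNgt => /negP; apply.
have -> : (`|a| + 1) / - b * b = - (`|a| + 1).
  by field; rewrite lt_eqF.
by have := ler_norm a; lra.
Qed.

End Coordinates.

(** * Differentials of the components of the constraint map *)

Section Differentials.
Context {R : realType} {X : normedModType R} {m n : nat}.
Context (g : X -> 'rV[R]_(m + n)) (x : X).
Hypothesis dg : differentiable g x.

Lemma diff_row_coord i u : 'd (fun y => g y 0 i : R^o) x u = 'd g x u 0 i.
Proof.
have lh : linear (fun z : 'rV[R]_(m + n) => z 0 i : R^o).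
  by move=> t y z; rewrite !mxE.
by have := diff_comp_linear lh (@coord_continuous _ _ _ _ _) dg => /= ->.
Qed.

Lemma diff_ineq_coord i u :
  'd (ineq_coord g i) x u = 'd g x u 0 (lshift n i).
Proof. exact: diff_row_coord. Qed.

Lemma diff_eq_coord j u : 'd (eq_coord g j) x u = 'd g x u 0 (rshift m j).
Proof. exact: diff_row_coord. Qed.

Lemma diff_eq_part u : 'd (eq_part g) x u = rsubmx ('d g x u).
Proof.
have -> : eq_part g = rsubmx \o g.
  by apply/funext => y; apply/rowP => j; rewrite !mxE.
have lh : linear (rsubmx : 'rV[R]_(m + n) -> 'rV[R]_n).
  by move=> t y z; apply/rowP => j; rewrite !mxE.
have ch : continuous (rsubmx : 'rV[R]_(m + n) -> 'rV[R]_n).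
  by move=> z; apply: differentiable_continuous; exact: differentiable_rsubmx.
by have := diff_comp_linear lh ch dg => /= ->.
Qed.

End Differentials.

(** * The cone to be separated from 0 *)

Section Multipliers.
Context {R : realType} {X : normedModType R} {k m n : nat}.
Context (K : set 'rV[R]_k) (L : set X) (xbar : X).
Context (f : X -> 'rV[R]_k) (g : X -> 'rV[R]_(m + n)).

Definition active (i : 'I_m) : Prop := ineq_coord g i xbar = 0.

(** Inactive rows are left free: a functional nonnegative on such z must ignore them, which is
    complementary slackness. *)
Definition slack (z : 'rV[R]_(m + n)) : Prop :=
  (forall i : 'I_m, active i -> 0 < z 0 (lshift n i)) /\
  (forall j : 'I_n, z 0 (rshift m j) = 0).

Definition primal_cone : set ('rV[R]_k * 'rV[R]_(m + n)) :=
  [set v | exists u, [/\ cone L u, interior K (v.1 - 'd f xbar u) &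
                         slack (v.2 - 'd g xbar u)]].

Lemma slackD z1 z2 : slack z1 -> slack z2 -> slack (z1 + z2).
Proof.
move=> [p1 e1] [p2 e2]; split=> [i ai|j]; rewrite mxE.
  by apply: addr_gt0; [apply: p1|apply: p2].
by rewrite e1 e2 addr0.
Qed.

Lemma slackZ t z : 0 < t -> slack z -> slack (t *: z).
Proof.
move=> t0 [pz ez]; split=> [i ai|j]; rewrite mxE.
  by apply: mulr_gt0 => //; apply: pz.
by rewrite ez mulr0.
Qed.

Hypothesis hK : proper_convex_cone K.
Hypothesis hL0 : L !=set0.
Hypothesis hL : convex_set (cone L).

Lemma K_scale t y : 0 < t -> K y -> K (t *: y).
Proof. by case: hK => _ KZ _ _ _ t0 Ky; apply: KZ; exists t, y; rewrite ltW. Qed.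

Lemma K_add y1 y2 : K y1 -> K y2 -> K (y1 + y2).
Proof. by case: hK => _ _ Kc _ _; apply: convex_coneD => //; exact: K_scale. Qed.

Lemma coneL_add u1 u2 : cone L u1 -> cone L u2 -> cone L (u1 + u2).
Proof. by apply: convex_coneD => // t u t0; apply/coneZ/ltW. Qed.

Lemma primal_coneD v w :
  primal_cone v -> primal_cone w -> primal_cone (v + w).
Proof.
move=> [u [Cu Ku su]] [u' [Cu' Ku' su']]; exists (u + u'); split.
- exact: coneL_add.
- rewrite /= linearD opprD addrACA; apply: interior_coneD => //.
    exact: K_add.
  exact: interior_subset.
- by rewrite /= linearD opprD addrACA; apply: slackD.
Qed.

Lemma primal_coneZ t v : 0 < t -> primal_cone v -> primal_cone (t *: v).
Proof.
move=> t0 [u [Cu Ku su]]; exists (t *: u); split.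
- exact/coneZ/Cu/ltW.
- rewrite /= linearZ -scalerBr; apply: interior_coneZ => //; exact: K_scale.
- by rewrite /= linearZ -scalerBr; apply: slackZ.
Qed.

Hypothesis hf : differentiable f xbar.
Hypothesis hg : differentiable g xbar.

(** In - g, active rows start at 0 and grow linearly, inactive rows start positive and stay so for
    small t, and equality rows remain 0. *)
Lemma slack_tangent u : setopp Qcone (g xbar) -> slack (- 'd g xbar u) ->
  exists2 d : R, 0 < d &
    forall t, 0 < t < d -> setopp Qcone (g xbar + t *: 'd g xbar u).
Proof.
rewrite setoppE => -[gp ge] [sp se].
pose P (i : 'I_(m + n)) := 0 < (- g xbar) 0 i.
have [d d0 Hd] := nbhs_segment (- 'd g xbar u)
  (@nbhs_coord_gt0 _ _ P (- g xbar) (fun i => id)).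
exists d => // t /andP[t0 td]; rewrite setoppE opprD -scalerN; split=> [i|j].
  have [gi|gi] := eqVneq ((- g xbar) 0 (lshift n i)) 0.
    rewrite mxE gi add0r mxE mulr_ge0 ?ltW// sp//.
    by move/eqP: gi; rewrite mxE oppr_eq0 => /eqP.
  by rewrite ltW// Hd ?gtr0_norm// /P lt_neqAle eq_sym gi gp.
by rewrite mxE ge add0r mxE se mulr0.
Qed.

Hypothesis hmin : local_weak_dir_pareto_min f (g @^-1` setopp Qcone) K L xbar.
Hypothesis hsub : metrically_subregular sum_norm
  (fun w : X * 'rV[R]_(m + n) => g w.1 - w.2) (xbar, g xbar)
  (translate xbar (cone L) `*` setopp Qcone).

Lemma primal_cone0 : ~ primal_cone 0.
Proof.
move=> [u [Cu]]; rewrite /= !sub0r => Ku su.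
apply: (no_descent_direction (u := u) K_scale hmin hf _ Ku).
have [d d0 Hd] := slack_tangent hmin.1 su.
apply: (subregular_tangent hg hsub); exists d => // t /[dup] td /andP[t0 _].
split; last exact: Hd.
by exists (t *: u) => //; apply/coneZ/Cu/ltW.
Qed.

Lemma primal_cone_absorbing (ubar : X) (y0 : 'rV[R]_k) v :
  range ('d (eq_part g) xbar) = setT ->
  interior (cone L) ubar -> interior K y0 ->
  exists2 t, 0 < t & primal_cone
    (('d f xbar ubar + y0, 'd g xbar ubar + row_mx (const_mx 1) 0) + t *: v).
Proof.
move=> surj Cubar Ky0; case: v => v1 v2.
(* Perturbing [ubar] by t w absorbs the equality rows of t v exactly; all remaining requirements are
   open conditions, valid for small t. *)
have [w _] : range ('d (eq_part g) xbar) (rsubmx v2) by rewrite surj.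
rewrite diff_eq_part// => dgw.
have [d1 d10 H1] := nbhs_segment w Cubar.
have K2 : nbhs y0 (interior K) by have := open_interior K; rewrite openE; apply.
have [d2 d20 H2] := nbhs_segment (v1 - 'd f xbar w) K2.
pose z0 : 'rV[R]_(m + n) := row_mx (const_mx 1) 0.
pose P (i : 'I_(m + n)) := 0 < z0 0 i.
have [d3 d30 H3] := nbhs_segment (v2 - 'd g xbar w)
  (@nbhs_coord_gt0 _ _ P z0 (fun i => id)).
pose d := Num.min (Num.min d1 d2) d3.
have d0 : 0 < d by rewrite !lt_min d10 d20.
have t0 : 0 < d / 2 by rewrite divr_gt0.
have : `|d / 2| < d by rewrite gtr0_norm// gtr_pMr// invf_lt1// ltr1n.
move: (d / 2) t0 => t t0; rewrite !lt_min => /andP[/andP[t1 t2] t3].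
exists t => //; exists (ubar + t *: w); split.
- exact: H1.
- have -> : 'd f xbar (ubar + t *: w) = 'd f xbar ubar + t *: 'd f xbar w.
    by rewrite linearD linearZ.
  rewrite /= opprD addrACA [_ + y0]addrC addrK -scalerBr; exact: H2.
- have -> : 'd g xbar (ubar + t *: w) = 'd g xbar ubar + t *: 'd g xbar w.
    by rewrite linearD linearZ.
  rewrite /= opprD addrACA [_ + row_mx _ _]addrC addrK -scalerBr; split=> [i _|j].
    by apply: H3 => //; rewrite /P /z0 row_mxEl mxE.
  rewrite mxE row_mxEr !mxE add0r.
  have /rowP/(_ j) := dgw; rewrite !mxE => ->.
  by rewrite subrr mulr0.
Qed.

End Multipliers.

(** * Reading the multipliers off the separating functional *)

Theorem theorem3p13 (R : realType) (X : completeNormedModType R)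
    (k m n : nat) (hk : (1 <= k)%N) (hp : (1 <= m + n)%N)
    (K : set 'rV[R]_k) (hK : proper_convex_cone K)
    (hintK : interior K !=set0)
    (L : set X) (hLS : L `<=` unit_sphere) (hL0 : L !=set0) (hLc : closed L)
    (f : X -> 'rV[R]_k) (g : X -> 'rV[R]_(m + n))
    (hf : forall x, differentiable f x) (hg : forall x, differentiable g x)
    (xbar : X)
    (hmin : local_weak_dir_pareto_min f (g @^-1` setopp Qcone) K L xbar)
    (h_i : convex_set (cone L))
    (h_ii : metrically_subregular sum_norm
              (fun w : X * 'rV[R]_(m + n) => g w.1 - w.2) (xbar, g xbar)
              (translate xbar (cone L) `*` setopp Qcone))
    (h_iii : range ('d (eq_part g) xbar) = setT)
    (h_iv : exists2 ubar : X, interior (cone L) ubar &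
              (forall i : 'I_m, ineq_coord g i xbar = 0 ->
                 'd (ineq_coord g i) xbar ubar < 0) /\
              'd (eq_part g) xbar ubar = 0) :
  exists (ystar : 'rV[R]_k -> R^o) (lambda : 'I_m -> R) (tau : 'I_n -> R),
    [/\ dual_cone K ystar /\ ystar <> 0,
        forall i, 0 <= lambda i,
        [set ystar \o 'd f xbar
             + \sum_(i < m) lambda i *: ('d (ineq_coord g i) xbar : X -> R^o)
             + \sum_(j < n) tau j *: ('d (eq_coord g j) xbar : X -> R^o)
             + xstar | xstar in polar_cone L] 0 &
        forall i, lambda i * ineq_coord g i xbar = 0].
Proof.
set df := 'd f xbar; set dg := 'd g xbar.
have dfx := hf xbar; have dgx := hg xbar.
have [ubar Cubar [dmu_lt0 dnu0]] := h_iv.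
have [y0 Ky0] := hintK.
pose z0 : 'rV[R]_(m + n) := row_mx (const_mx 1) 0.
have [phi [phi_ge0 phi_s0]] := cone_separation
  (primal_coneD hK h_i (xbar := xbar) (f := f) (g := g)) (primal_coneZ hK)
  (fun v => primal_cone_absorbing f dgx v h_iii Cubar Ky0)
  (primal_cone0 hK dfx dgx hmin h_ii).
pose ystar y : R^o := phi (y, 0).
pose zeta z : R^o := phi (0, z).
have phiE y z : phi (y, z) = ystar y + zeta z.
  by rewrite /ystar /zeta -linearD -[(_, 0) + _]/(y + 0, 0 + z) addr0 add0r.
have phiP t y z y' z' : phi (t *: y + y', t *: z + z') =
    t *: (phi (y, z) : R^o) + phi (y', z') by rewrite -linearP.
have ystar_lin : linear ystar.
  by move=> t y1 y2; rewrite -phiP scaler0 addr0.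
have zeta_lin : linear zeta.
  by move=> t z1 z2; rewrite -phiP scaler0 addr0.
have key u y z : cone L u -> interior K y -> slack xbar g z ->
    0 <= phi (df u, dg u) + phi (y, z).
  move=> Cu Ky sz; rewrite -linearD; apply: phi_ge0; exists u.
  by rewrite /= ![_ + _ - _]addrAC !subrr !add0r.
have z0l i : z0 0 (lshift n i) = 1 by rewrite row_mxEl mxE.
have z0r j : z0 0 (rshift m j) = 0 by rewrite row_mxEr mxE.
have sz0 : slack xbar g z0 by split=> [i _|j]; rewrite ?z0l ?z0r.
pose psi u := phi (df u, dg u).
have psi_ge0 u : cone L u -> 0 <= psi u.
  (* The base (y0, z0) stays fixed while u is replaced by t u with t arbitrarily large. *)
  move=> Cu; apply: (@ge0_affine_slope _ (phi (y0, z0))) => t t0.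
  have := key (t *: u) y0 z0 (coneZ (ltW t0) Cu) Ky0 sz0.
  rewrite addrC /psi -linearZ.
  by rewrite -[t *: (_, _)]/(t *: df u, t *: dg u) -!linearZ.
have pair_ge0 y z : interior K y -> slack xbar g z -> 0 <= ystar y + zeta z.
  move=> Ky sz; have := key 0 y z (cone0 hL0) Ky sz.
  by rewrite !linear0 add0r phiE.
pose lambda (i : 'I_m) : R := zeta (delta_mx 0 (lshift n i)).
pose tau (j : 'I_n) : R := zeta (delta_mx 0 (rshift m j)).
have zetaE z : zeta z = \sum_i z 0 (lshift n i) * lambda i
                      + \sum_j z 0 (rshift m j) * tau j.
  pose zM := GRing.isLinear.Build _ _ _ _ _ zeta_lin.
  pose zetaL : {linear 'rV[R]_(m + n) -> R^o} := HB.pack zeta zM.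
  rewrite -[zeta]/(zetaL : _ -> _) {1}(row_sum_delta z) linear_sum big_split_ord.
  by congr (_ + _); apply: eq_bigr => i _; rewrite linearZ.
(* For an inactive row the coefficient may have either sign, so testing with t and - t forces
   [lambda i] to be 0. *)
have slack_delta i (c : R) : 0 <= c \/ ~ active xbar g i ->
    slack xbar g (c *: delta_mx 0 (lshift n i) + z0).
  move=> ci; split=> [i' ai'|j].
    rewrite mxE z0l !mxE eqxx /= eq_lshift.
    have [ii'|_] := eqVneq i' i; last by rewrite mulr0 add0r.
    by case: ci => [c0|]; [rewrite mulr1 ltr_wpDl | rewrite -ii'].
  by rewrite mxE z0r !mxE eqxx /= eq_rlshift mulr0 addr0.
have lambda_ge0 i : 0 <= lambda i.
  apply: (@ge0_affine_slope _ (ystar y0 + zeta z0)) => t t0.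
  have := pair_ge0 y0 _ Ky0 (slack_delta i t (or_introl (ltW t0))).
  by rewrite zeta_lin addrCA addrC.
have lambda0 i : ~ active xbar g i -> lambda i = 0.
  move=> nai; apply: le_anti; rewrite lambda_ge0 andbT -oppr_ge0.
  apply: (@ge0_affine_slope _ (ystar y0 + zeta z0)) => t t0.
  have := pair_ge0 y0 _ Ky0 (slack_delta i (- t) (or_intror nai)).
  by rewrite zeta_lin addrCA addrC mulrN -mulNr.
have ystar_ge0 y : K y -> 0 <= ystar y.
  move=> Ky; apply: (@ge0_affine_slope _ (ystar y0 + zeta z0)) => t t0.
  (* Adding the interior point [y0] moves any multiple of y in [K] into the interior. *)
  have Kty : interior K (t *: y + y0).
    rewrite addrC; apply: interior_coneD => //; first exact: (K_add hK).
    exact: (K_scale hK).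
  by have := pair_ge0 _ _ Kty sz0; rewrite ystar_lin -addrA addrC.
have ystar_neq0 : ystar <> 0.
  move=> ystar0.
  have phi_zeta y z : phi (y, z) = zeta z by rewrite phiE ystar0 add0r.
  have dg_eq j : dg ubar 0 (rshift m j) = 0.
    by have /rowP/(_ j) := dnu0; rewrite diff_eq_part// !mxE.
  have sum_tau0 (z : 'rV[R]_(m + n)) : (forall j, z 0 (rshift m j) = 0) ->
      zeta z = \sum_i z 0 (lshift n i) * lambda i.
    move=> z_eq; rewrite zetaE [X in _ + X]big1 ?addr0// => j _.
    by rewrite z_eq mul0r.
  have term_le0 i : dg ubar 0 (lshift n i) * lambda i <= 0.
    have [ai|nai] := pselect (active xbar g i); last by rewrite lambda0 ?mulr0.
    rewrite mulr_le0_ge0// ltW//.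
    by have := dmu_lt0 _ ai; rewrite diff_ineq_coord.
  have lambda_eq0 i : lambda i = 0.
    have [ai|nai] := pselect (active xbar g i); last exact: lambda0.
    have := psi_ge0 _ (interior_subset Cubar).
    (* At [ubar] a sum of nonpositive terms is nonnegative, so every term vanishes; an active one
       has a negative factor, whence [lambda i] = 0. *)
    rewrite /psi phi_zeta sum_tau0// -oppr_le0 -sumrN.
    have tge0 i' : true -> 0 <= - (dg ubar 0 (lshift n i') * lambda i').
      by rewrite oppr_ge0.
    move=> sum_le0.
    have /eqP := le_anti (introT andP (conj sum_le0 (sumr_ge0 _ tge0))).
    rewrite psumr_eq0// => /allP/(_ i (mem_index_enum _)).
    rewrite /= oppr_eq0 mulf_eq0 => /orP[|/eqP//].
    by have := dmu_lt0 _ ai; rewrite diff_ineq_coord// => /lt_eqF ->.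
  (* The equality rows of the base point are 0, so [tau] does not enter its value, which is then 0
     instead of positive. *)
  move: phi_s0; rewrite phi_zeta sum_tau0 => [|j].
    by rewrite big1 ?ltxx// => i _; rewrite lambda_eq0 mulr0.
  by rewrite mxE dg_eq add0r z0r.
have psi_lin : linear psi by move=> t u v; rewrite /psi !linearP phiP.
have dfc : continuous df := diff_continuous dfx.
have dgc : continuous dg := diff_continuous dgx.
have yc := linear_row_continuous ystar_lin.
have zc := linear_row_continuous zeta_lin.
have ydc u := continuous_comp (dfc u) (yc (df u)).
have zdc u := continuous_comp (dgc u) (zc (dg u)).
have psi_cont : continuous psi.
  move=> u; rewrite (_ : psi = fun u => ystar (df u) + zeta (dg u)); last first.
    by apply/funext => v; rewrite /psi phiE.
  by apply: cvgD; [exact: ydc | exact: zdc].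
have ystar_dual : dual_cone K ystar := conj (conj ystar_lin yc) ystar_ge0.
exists ystar, lambda, tau; split=> //; last first.
- move=> i; have [ai|nai] := pselect (active xbar g i).
    by rewrite ai mulr0.
  by rewrite lambda0 ?mul0r.
(* [psi] is the whole sum of the other terms and is nonnegative on [cone L], so its opposite is the
   required element of the polar cone. *)
exists (fun u => - psi u); first split; first split.
- by move=> t u v; rewrite psi_lin opprD scalerN.
- by move=> u; apply: cvgN; exact: psi_cont.
- by move=> l Ll; rewrite oppr_le0; apply/psi_ge0/subset_cone.
apply/funext => u.
have sumE p (F : 'I_p -> X -> R^o) : (\sum_i F i) u = \sum_i F i u.
  by apply: (big_morph (fun h : X -> R^o => h u)).
rewrite !fctE !sumE /psi phiE zetaE.
have -> : \sum_i (lambda i *: ('d (ineq_coord g i) xbar : X -> R^o)) u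
    = \sum_i dg u 0 (lshift n i) * lambda i :> R.
  by apply: eq_bigr => i _; rewrite fctE diff_ineq_coord// mulrC.
have -> : \sum_i (tau i *: ('d (eq_coord g i) xbar : X -> R^o)) u
    = \sum_j dg u 0 (rshift m j) * tau j :> R.
  by apply: eq_bigr => j _; rewrite fctE diff_eq_coord// mulrC.
by rewrite -[X in X - _]addrA subrr.
Qed.
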